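(* Let $E$ be a real Banach space, $P\subset E$ a cone with nonempty interior, and let $(X,d_X)$ and $(Y,d_Y)$ be quasi cone metric spaces over $(E,P)$. Suppose that $X$ is forward compact, that in $Y$ forward convergence implies backward convergence, and that every subset of $Y$ which is forward bounded and forward closed is forward compact. Endow the space $C(X,Y)$ of all $ff$-continuous functions from $X$ to $Y$ with the uniform metric $\bar\rho$ corresponding to $d_Y$. If a set $\mathcal S\subset C(X,Y)$ is forward equicontinuous and forward pointwise bounded under $d_Y$, then $\mathcal S$ is forward relatively compact in $(C(X,Y),\bar\rho)$.
   Context: Let $E$ be a real Banach space. A subset $P\subset E$ is a cone if (i) $P$ is closed, $P\neq\emptyset$, $P\neq\{0\}$; (ii) $sx+ty\in P$ for all $x,y\in P$ and all real $s,t\ge 0$; (iii) $x\in P$ and $-x\in P$ imply $x=0$. $P$ is assumed to have nonempty interior $P^\circ$. Write $x\le y$ iff $y-x\in P$, and $x\ll y$ iff $y-x\in P^\circ$; thus $u\gg 0$ means $u\in P^\circ$. A quasi cone metric space $(X,d)$ over $(E,P)$ is a nonempty set $X$ with a map $d:X\times X\to E$ such that for all $x,y,z\in X$: $d(x,y)\ge 0$; $d(x,y)=0$ iff $x=y$; $d(x,y)\le d(x,z)+d(z,y)$. (No symmetry is assumed.) Forward balls: $B_f(x,u)=\{y\in X: d(x,y)\ll u\}$ for $x\in X$, $u\in P^\circ$. They generate the forward topology $T_f$. A set is forward closed if its complement belongs to $T_f$. A set $A\subset X$ is forward compact if every cover of $A$ by $T_f$-open sets has a finite subcover; it is forward relatively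 compact if its closure in $T_f$ is forward compact; it is forward bounded if $A\subset B_f(x,u)$ for some $x\in X$ and $u\gg0$. A sequence $(x_n)$ is forward (resp. backward) convergent to $x$ if for each $u\in P^\circ$ there is $N\in\mathbb N$ with $d(x,x_n)\ll u$ (resp. $d(x_n,x)\ll u$) for all $n\ge N$. ''Forward convergence implies backward convergence'' means that every sequence forward convergent to a point $x$ is backward convergent to $x$. A function $f:X\to Y$ is $ff$-continuous if for every $x\in X$ and every sequence $(x_n)$ forward convergent to $x$ in $X$, $(f(x_n))$ is forward convergent to $f(x)$ in $Y$. A set $\mathcal S$ of functions from $X$ to $Y$ is forward equicontinuous if for every $x\in X$ and every $u\gg0$ there is $w\gg0$ such that $d_Y(f(x),f(y))\ll u$ for every $f\in\mathcal S$ and every $y\in X$ with $d_X(x,y)\ll w$. It is forward pointwise bounded with respect to $d_Y$ if for each $b\in X$ the set $\mathcal S_b=\{f(b):f\in\mathcal S\}\subset Y$ is forward bounded in $(Y,d_Y)$. Uniform metric: fix an element of $P^\circ$ denoted $1$. Put $\bar d_Y(y,y')=\min\{d_Y(y,y'),1\}$ and $\bar\rho(f,g)=\sup\{\bar d_Y(f(x),g(x)):x\in X\}$ for $f,g:X\to Y$, where $\min$ and $\sup$ denote greatest lower bound and least upper bound in $E$ with respect to $\le$, assumed to exist. In $(C(X,Y),\bar\rho)$ the forward balls are the sets $\{g\in C(X,Y): \bar\rho(f,g)\ll u\}$ for $f\in C(X,Y)$, $u\in P^\circ$, and they generate the forward topology of $(C(X,Y),\bar\rho)$. A set $\mathcal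 A\subset C(X,Y)$ is forward compact in $(C(X,Y),\bar\rho)$ if every cover of $\mathcal A$ by sets open in this forward topology has a finite subcover; it is forward relatively compact in $(C(X,Y),\bar\rho)$ if its closure in this forward topology is forward compact in $(C(X,Y),\bar\rho)$. *)

(* Defs.v *)
From HB Require Import structures.
From mathcomp Require Import all_boot all_order all_algebra.
From mathcomp Require Import boolp classical_sets functions reals.
From mathcomp Require Import topology normedtype.
Set Implicit Arguments.
Unset Strict Implicit.
Unset Printing Implicit Defensive.
Import Order.TTheory GRing.Theory Num.Theory.
Import numFieldNormedType.Exports.
Local Open Scope classical_set_scope.
Local Open Scope ring_scope.

Record is_cone (R : realType) (E : completeNormedModType R) (P : set E) :
    Prop := IsCone {
  cone_closed : closed P ;
  cone_nonempty : P !=set0 ;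
  cone_neq0 : P <> [set 0] ;
  cone_comb : forall (s t : R) (x y : E),
    0 <= s -> 0 <= t -> P x -> P y -> P (s *: x + t *: y) ;
  cone_pointed : forall x : E, P x -> P (- x) -> x = 0 }.

Section ConeOrder.
Context {R : realType} {E : completeNormedModType R}.
Variable P : set E.

Definition cone_le (x y : E) : Prop := P (y - x).
Definition cone_ll (x y : E) : Prop := interior P (y - x).

Definition is_cone_glb (A : set E) (m : E) : Prop :=
  (forall a, A a -> cone_le m a) /\
  (forall b, (forall a, A a -> cone_le b a) -> cone_le b m).

Definition is_cone_lub (A : set E) (m : E) : Prop :=
  (forall a, A a -> cone_le a m) /\
  (forall b, (forall a, A a -> cone_le a b) -> cone_le m b).

(* Junk value 0 when the bound does not exist. *)
Definition cone_inf (A : set E) : E := xget 0 [set m | is_cone_glb A m].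
Definition cone_sup (A : set E) : E := xget 0 [set m | is_cone_lub A m].

End ConeOrder.

Record is_quasi_cone_metric (R : realType) (E : completeNormedModType R)
    (P : set E) (X : Type) (d : X -> X -> E) : Prop := IsQuasiConeMetric {
  qcm_inhabited : inhabited X ;
  qcm_ge0 : forall x y, cone_le P 0 (d x y) ;
  qcm_eq0 : forall x y, d x y = 0 <-> x = y ;
  qcm_triangle : forall x y z, cone_le P (d x y) (d x z + d z y) }.

Definition fwd_ball (R : realType) (E : completeNormedModType R) (P : set E)
    (X : Type) (d : X -> X -> E) (x : X) (u : E) : set X :=
  [set y | cone_ll P (d x y) u].

(* The type X, endowed below with the forward topology of d: the topology
   having the forward balls of radius in the interior of P as a subbase. *)
Definition fwd_space (R : realType) (E : completeNormedModType R) (P : set E)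
    (X : Type) (d : X -> X -> E) : Type := X.

Section ForwardTopology.
Context {R : realType} {E : completeNormedModType R}.
Variables (P : set E) (X : Type) (d : X -> X -> E).

Definition fwd_balls : set (set (fwd_space P d)) :=
  [set B | exists x u, interior P u /\ B = fwd_ball P d x u].

HB.instance Definition _ := gen_eqMixin (fwd_space P d).
HB.instance Definition _ := gen_choiceMixin (fwd_space P d).
HB.instance Definition _ :=
  isSubBaseTopological.Build (fwd_space P d) fwd_balls id.

Definition fwd_closed (A : set X) : Prop := closed (A : set (fwd_space P d)).

Definition fwd_compact (A : set X) : Prop :=
  cover_compact (A : set (fwd_space P d)).

Definition fwd_relatively_compact (A : set X) : Prop :=
  fwd_compact (closure (A : set (fwd_space P d))).

Definition fwd_bounded (A : set X) : Prop :=
  exists x u, interior P u /\ A `<=` fwd_ball P d x u.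

Definition fwd_cvg (x_ : nat -> X) (x : X) : Prop :=
  forall u, interior P u ->
    exists N : nat, forall n, (N <= n)%N -> cone_ll P (d x (x_ n)) u.

Definition bwd_cvg (x_ : nat -> X) (x : X) : Prop :=
  forall u, interior P u ->
    exists N : nat, forall n, (N <= n)%N -> cone_ll P (d (x_ n) x) u.

End ForwardTopology.

Section FunctionSpace.
Context {R : realType} {E : completeNormedModType R}.
Variables (P : set E) (X Y : Type) (dX : X -> X -> E) (dY : Y -> Y -> E).

Definition ff_continuous (f : X -> Y) : Prop :=
  forall (x : X) (x_ : nat -> X),
    fwd_cvg P dX x_ x -> fwd_cvg P dY (f \o x_) (f x).

Definition ff_map : Type := {f : X -> Y | ff_continuous f}.

Definition fwd_equicontinuous (S : set (X -> Y)) : Prop :=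
  forall (x : X) (u : E), interior P u ->
    exists w, interior P w /\
      forall f y, S f -> cone_ll P (dX x y) w -> cone_ll P (dY (f x) (f y)) u.

Definition fwd_pointwise_bounded (S : set (X -> Y)) : Prop :=
  forall b : X, fwd_bounded P dY [set f b | f in S].

(* e is the fixed element of the interior of P that plays the role of 1. *)
Variable e : E.

Definition trunc_pair (y y' : Y) : set E := [set z | z = dY y y' \/ z = e].

Definition trunc_dist (y y' : Y) : E := cone_inf P (trunc_pair y y').

Definition unif_values (f g : X -> Y) : set E :=
  [set trunc_dist (f x) (g x) | x in [set: X]].

Definition unif_dist (f g : X -> Y) : E := cone_sup P (unif_values f g).

Definition unif_dist_exists : Prop :=
  (forall y y' : Y, exists m, is_cone_glb P (trunc_pair y y') m) /\
  (forall f g : X -> Y, exists m, is_cone_lub P (unif_values f g) m).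

Definition unif_metric (f g : ff_map) : E := unif_dist (sval f) (sval g).

End FunctionSpace.

(* Main.v *)
Require Import Defs.
From HB Require Import structures.
From mathcomp Require Import all_boot all_order all_algebra finmap lra.
From mathcomp Require Import boolp classical_sets functions reals.
From mathcomp Require Import interval_inference.
From mathcomp Require Import topology normedtype.
Set Implicit Arguments.
Unset Strict Implicit.
Unset Printing Implicit Defensive.
Import Order.TTheory GRing.Theory Num.Theory.
Import numFieldNormedType.Exports.
Local Open Scope classical_set_scope.
Local Open Scope ring_scope.

(** This is Ascoli's theorem for asymmetric distances, proved with ultrafilters.
    Distances are reversed only at a fixed centre: if forward convergence to [y]
    implies backward convergence to [y], then every [u >> 0] admits [w >> 0]
    such that [d y z << w] implies [d z y << u] (lemma [fwd_bwd_ball], where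
    first countability comes from the radii [u / (n + 1)]).

    This reversal has two direct consequences.  In [Y], the closure of a forward
    bounded set is again forward bounded ([fwd_bounded_closure]), hence compact
    by the Heine-Borel hypothesis.  Forward equicontinuity passes to limits taken at
    two points at a time ([fwd_equicontinuous_approx]): in
    [d (g x) (g y) <= d (g x) (f x) + d (f x) (f y) + d (f y) (g y)] only the
    last term is in the wrong direction, and the approximating [f] may be
    chosen after [x] and [y], so no uniform control of the reversal is needed.

    Now let [F] be an ultrafilter containing the closure [C] of [S].  For every
    [x] the values at [x] of the elements of [C] lie in the compact closure of
    [{f x | f in S}], so [F] converges pointwise to some [g].  By the previous
    paragraph [C] is equicontinuous, and then so is [{g}]; in particular [g] is
    [ff]-continuous.  Cover [X] by finitely many balls centred at [x_i] on which
    both the oscillation of [C] and the reversed distance [d (g y) (g x_i)] are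
    small.  Then
    [d (g y) (f y) <= d (g y) (g x_i) + d (g x_i) (f x_i) + d (f x_i) (f y)]
    shows that [F] converges to [g] uniformly, and [g] lies in [C] because [C]
    is closed.

    Passing between the uniform distance and [d] takes one argument about the
    order: the greatest lower bound of [d y y'] and [e] being small forces
    [d y y'] itself to be small ([dist_le_of_trunc]).  In an ordered space which
    is not a lattice this is not immediate. *)

(** * Compactness without a base point *)

(** A forward space carries no base point; a nonempty set provides one, which
    reduces the equivalence to the case of pointed spaces. *)
Lemma compact_cover_compact (T : topologicalType) (A : set T) :
  compact A <-> cover_compact A.
Proof.
have [->|/set0P[p Ap]] := eqVneq A set0.
  split=> _; last exact: compact0.
  by move=> I D f _ _; exists fset0%fset.
pose T' : ptopologicalType := HB.pack T (isPointed.Build T p).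
by rewrite -[compact A]/(@compact T' A) (@compact_cover T').
Qed.

Lemma ultra_fmap (U V : Type) (h : U -> V) (F : set_system U) :
  UltraFilter F -> UltraFilter (h @ F).
Proof.
move=> FU; split=> [|G GP FG]; first exact: fmap_proper_filter.
rewrite predeqE => A; split=> [GA|]; last exact: FG.
have [//|FnA] := in_ultra_setVsetC (h @^-1` A) FU.
have GnA : G (~` A) by exact: FG.
by have /filter_ex[? []] : G (A `&` ~` A) by exact: filterI.
Qed.

(** * Order and interior of a cone *)

Section Cone.
Context {R : realType} {E : completeNormedModType R} {P : set E}.
Hypothesis hP : is_cone P.

Lemma coneD x y : P x -> P y -> P (x + y).
Proof.
by move=> Px Py; have := cone_comb hP ler01 ler01 Px Py; rewrite !scale1r.
Qed.

Lemma coneZ t x : 0 <= t -> P x -> P (t *: x).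
Proof.
move=> t0 Px; have := cone_comb hP t0 (lexx 0) Px Px.
by rewrite scale0r addr0.
Qed.

Lemma cone0 : P 0.
Proof.
by have [x Px] := cone_nonempty hP; rewrite -(scale0r x); exact: coneZ.
Qed.

Lemma interior_coneD x y : interior P x -> P y -> interior P (x + y).
Proof.
rewrite /interior/= => /nbhs_ballP[r r0 rP] Py.
apply/nbhs_ballP; exists r => //.
move=> z; rewrite -ball_normE /= => xyz.
rewrite -(subrK y z); apply: coneD => //; apply: rP.
by rewrite -ball_normE /= opprB addrA.
Qed.

Lemma interior_coneZ a x : 0 < a -> interior P x -> interior P (a *: x).
Proof.
rewrite /interior/= => a0 /nbhs_ballP[r /= r0 rP].
apply/nbhs_ballP; exists (a * r) => /=; first exact: mulr_gt0.
move=> z; rewrite -ball_normE /= => axz.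
have -> : z = a *: (a^-1 *: z) by rewrite scalerA divff ?scale1r// gt_eqF.
apply: coneZ (ltW a0) _; apply: rP; rewrite -ball_normE /=.
rewrite -(ltr_pM2l a0) -{1}(gtr0_norm a0) -normrZ scalerBr scalerA.
by rewrite divff ?gt_eqF// scale1r.
Qed.

(** This is what allows an interior radius to be scaled below another one, and a
    vector to be bounded by a multiple of an interior point. *)
Lemma interior_coneB w v : interior P w ->
  exists2 eps, 0 < eps & forall t, 0 < t < eps -> interior P (w - t *: v).
Proof.
move=> Pw; have : nbhs w (interior P).
  by apply: open_nbhs_nbhs; split=> //; exact: open_interior.
move=> /nbhs_ballP[r /= r0 rP].
have v1 : 0 < `|v| + 1 by rewrite ltr_wpDl.
exists (r / (`|v| + 1)); first by rewrite divr_gt0.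
move=> t /andP[t0]; rewrite ltr_pdivlMr// => tr; apply: rP.
rewrite -ball_normE /= opprB addrCA subrr addr0 normrZ (gtr0_norm t0).
by apply: le_lt_trans tr; rewrite ler_pM2l// lerDl.
Qed.

Lemma cone_le_refl x : cone_le P x x.
Proof. by rewrite /cone_le subrr; exact: cone0. Qed.

Lemma cone_le_trans y x z : cone_le P x y -> cone_le P y z -> cone_le P x z.
Proof. by rewrite /cone_le => xy yz; rewrite -(subrKA y); exact: coneD. Qed.

Lemma cone_le_addr x v : cone_le P 0 v -> cone_le P x (x + v).
Proof. by rewrite /cone_le subr0 addrAC subrr add0r. Qed.

Lemma cone_le_addl x v : cone_le P 0 v -> cone_le P x (v + x).
Proof. by rewrite addrC; exact: cone_le_addr. Qed.

Lemma cone_le_ll_trans y x z : cone_le P x y -> cone_ll P y z -> cone_ll P x z.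
Proof.
by rewrite /cone_ll => xy yz; rewrite -(subrKA y); exact: interior_coneD.
Qed.

Lemma cone_llW x y : cone_ll P x y -> cone_le P x y.
Proof. exact: interior_subset. Qed.

Lemma cone_le_subl x y z : cone_le P (x - y) z <-> cone_le P x (y + z).
Proof. by rewrite /cone_le opprB addrCA addrA. Qed.

Lemma cone_leD x y x' y' :
  cone_le P x y -> cone_le P x' y' -> cone_le P (x + x') (y + y').
Proof. by rewrite /cone_le opprD addrACA; exact: coneD. Qed.

Lemma cone_llD x y x' y' :
  cone_ll P x y -> cone_ll P x' y' -> cone_ll P (x + x') (y + y').
Proof.
rewrite /cone_ll opprD addrACA => xy xy'.
by apply: interior_coneD => //; exact: interior_subset.
Qed.

Lemma cone_ll_trans y x z : cone_ll P x y -> cone_ll P y z -> cone_ll P x z.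
Proof. by move=> xy; apply: cone_le_ll_trans; exact: cone_llW. Qed.

Lemma interior_cone_min u v : interior P u -> interior P v ->
  exists w, [/\ interior P w, cone_ll P w u & cone_ll P w v].
Proof.
move=> Pu Pv; have [a a0 ha] := interior_coneB u Pu.
have [b b0 hb] := interior_coneB u Pv.
have m0 : 0 < Num.min a b by rewrite lt_min a0.
have m2 : 0 < Num.min a b / 2 < Num.min a b.
  by rewrite divr_gt0//= gtr_pMr// invf_lt1 ?ltr1n.
have /andP[t0] := m2; rewrite lt_min => /andP[ta tb].
exists (Num.min a b / 2 *: u); split; first exact: interior_coneZ.
- by apply: ha; rewrite t0.
- by apply: hb; rewrite t0.
Qed.

Lemma interior_cone_half u : interior P u ->
  exists2 v, interior P v & v + v = u.
Proof.
move=> Pu; exists (2^-1 *: u).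
  by apply: interior_coneZ; rewrite ?invr_gt0.
by rewrite -scalerDl -[2^-1]mul1r -splitr scale1r.
Qed.

End Cone.

(** * The forward topology *)

Section ForwardTopology.
Context {R : realType} {E : completeNormedModType R} {P : set E}.
Hypothesis hP : is_cone P.
Context {X : Type} {d : X -> X -> E}.
Hypothesis d_refl : forall x, cone_le P (d x x) 0.
Hypothesis d_triangle : forall x y z, cone_le P (d x y) (d x z + d z y).

Lemma dist_refl_ll x u : interior P u -> cone_ll P (d x x) u.
Proof.
move=> Pu; apply: (cone_le_ll_trans hP) (d_refl x) _.
by rewrite /cone_ll subr0.
Qed.

Lemma dist_ll_triangle x y z u v :
  cone_ll P (d x z) u -> cone_ll P (d z y) v -> cone_ll P (d x y) (u + v).
Proof.
move=> xz zy; apply: (cone_le_ll_trans hP) (d_triangle x y z) _.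
exact: (cone_llD hP).
Qed.

Lemma open_fwd_ball x u :
  interior P u -> open (fwd_ball P d x u : set (fwd_space P d)).
Proof.
move=> Pu.
have fB : finI_from (@fwd_balls R E P X d) id (fwd_ball P d x u).
  by apply: finI_from1; exists x, u.
exists [set fwd_ball P d x u : set (fwd_space P d)]; first by move=> _ ->.
by rewrite bigcup_set1.
Qed.

Lemma nbhs_fwd_ball x u :
  interior P u -> nbhs (x : fwd_space P d) (fwd_ball P d x u).
Proof.
move=> Pu; apply: open_nbhs_nbhs; split; first exact: open_fwd_ball.
exact: dist_refl_ll.
Qed.

(** The triangle inequality makes the subbase of forward balls a base of
    neighbourhoods, in which every point is the centre of a smaller ball. *)
Lemma fwd_ball_shrink x y u : fwd_ball P d x u y ->
  interior P (u - d x y) /\ fwd_ball P d y (u - d x y) `<=` fwd_ball P d x u.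
Proof.
move=> xyu; split=> // z yz.
apply: (cone_le_ll_trans hP) (d_triangle x z y) _.
by rewrite /cone_ll opprD addrA.
Qed.

Lemma nbhs_fwdP (x : fwd_space P d) (A : set (fwd_space P d)) :
  interior P !=set0 ->
  nbhs x A -> exists2 u, interior P u & fwd_ball P d x u `<=` A.
Proof.
move=> [e Pe]; rewrite nbhsE => -[B [[D' D'D <-] [C D'C Cx]] BA].
have [D DB CE] := D'D _ D'C.
have ballsF : Filter (filter_from (interior P) (fwd_ball P d x)).
  apply: filter_from_filter => [|u v Pu Pv]; first by exists e.
  have [w [Pw wu wv]] := interior_cone_min hP Pu Pv.
  by exists w => // y xyw; split; apply: (cone_ll_trans hP) xyw _.
have [u Pu uC] : filter_from (interior P) (fwd_ball P d x) C.
  rewrite -CE; apply: filter_bigI => V DV.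
  have /set_mem[y [v [Pv VE]]] := DB _ DV.
  have yxv : fwd_ball P d y v x by rewrite -VE; move: Cx; rewrite -CE; apply.
  by rewrite VE; have [Pw] := fwd_ball_shrink yxv; exists (v - d y x).
by exists u => // y /uC Cy; apply: BA; exists C.
Qed.

Lemma closure_fwdP (A : set (fwd_space P d)) (x : fwd_space P d) u :
  interior P u -> closure A x -> exists2 y, A y & cone_ll P (d x y) u.
Proof.
by move=> Pu /(_ _ (nbhs_fwd_ball x Pu))[y []]; exists y.
Qed.

End ForwardTopology.

(** The sequential hypothesis in quantitative form: were it to fail for some [u],
    points [z_ n] in the balls of radius [u / (n + 1)] around [y] would converge
    forward but not backward. *)
Lemma fwd_bwd_ball {R : realType} {E : completeNormedModType R} {P : set E}
    (hP : is_cone P) {Y : Type} {d : Y -> Y -> E} (y : Y) (u : E) :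
  (forall y_ : nat -> Y, fwd_cvg P d y_ y -> bwd_cvg P d y_ y) ->
  interior P u ->
  exists2 w, interior P w &
    forall z, cone_ll P (d y z) w -> cone_ll P (d z y) u.
Proof.
move=> fb Pu; apply: contrapT => nw.
have inv0 n : 0 < n.+1%:R^-1 :> R by rewrite invr_gt0.
have /choice[z_ z_P] n :
    exists z, cone_ll P (d y z) (n.+1%:R^-1 *: u) /\ ~ cone_ll P (d z y) u.
  apply: contrapT => nz; apply: nw; exists (n.+1%:R^-1 *: u).
    exact: interior_coneZ.
  by move=> z yz; apply: contrapT => zy; apply: nz; exists z.
have /fb/(_ _ Pu)[N /(_ N (leqnn N))] : fwd_cvg P d z_ y;
  last by have [] := z_P N.
move=> w Pw; have [eps eps0 epsw] := interior_coneB u Pw.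
have [N _ Nlt] := near_infty_natSinv_lt (PosNum eps0).
exists N => n /Nlt/= neps; have [ynz _] := z_P n.
by apply: (cone_ll_trans hP) ynz _; apply: epsw; rewrite inv0.
Qed.

(** * The uniform distance *)

Section UniformDistance.
Context {R : realType} {E : completeNormedModType R} {P : set E}.
Hypothesis hP : is_cone P.
Context {X Y : Type} {d : Y -> Y -> E}.
Hypothesis d_ge0 : forall x y, cone_le P 0 (d x y).
Hypothesis d_refl : forall x, cone_le P (d x x) 0.
Hypothesis d_triangle : forall x y z, cone_le P (d x y) (d x z + d z y).
Context {e : E}.
Hypothesis Pe : interior P e.
Hypothesis hrho : unif_dist_exists P X d e.

Let delta := trunc_dist P d e.
Let rho : (X -> Y) -> (X -> Y) -> E := unif_dist P d e.

Lemma trunc_dist_glb y y' : is_cone_glb P (trunc_pair d e y y') (delta y y').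
Proof. by have := (@xgetPex _ 0 _ (hrho.1 y y')). Qed.

Lemma unif_dist_lub f g : is_cone_lub P (unif_values P d e f g) (rho f g).
Proof. by have := (@xgetPex _ 0 _ (hrho.2 f g)). Qed.

Lemma trunc_dist_le y y' : cone_le P (delta y y') (d y y').
Proof. by have [+ _] := trunc_dist_glb y y'; apply; left. Qed.

Lemma trunc_dist_le_unit y y' : cone_le P (delta y y') e.
Proof. by have [+ _] := trunc_dist_glb y y'; apply; right. Qed.

Lemma trunc_dist_ge y y' b :
  cone_le P b (d y y') -> cone_le P b e -> cone_le P b (delta y y').
Proof.
by move=> bd be; have [_] := trunc_dist_glb y y'; apply=> _ [|] ->.
Qed.

(** Translations preserve greatest lower bounds, so the sum of two of them is the
    greatest lower bound of the four pairwise sums, each of which bounds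
    [delta x y] from above. *)
Lemma trunc_dist_triangle x y z :
  cone_le P (delta x y) (delta x z + delta z y).
Proof.
have e_ge0 : cone_le P 0 e by rewrite /cone_le subr0; exact: interior_subset.
rewrite addrC -cone_le_subl; apply: trunc_dist_ge;
  rewrite cone_le_subl addrC -cone_le_subl; apply: trunc_dist_ge;
  rewrite cone_le_subl.
- exact: (cone_le_trans hP) (trunc_dist_le _ _) (d_triangle x y z).
- apply: (cone_le_trans hP) (trunc_dist_le_unit _ _) _; exact: cone_le_addl.
- apply: (cone_le_trans hP) (trunc_dist_le_unit _ _) _; exact: cone_le_addr.
- apply: (cone_le_trans hP) (trunc_dist_le_unit _ _) _; exact: cone_le_addr.
Qed.

(** If [d <= t e] with [1 <= t], then [d - (t - 1) e] is a lower bound of both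
    [d] and [e], so it lies below [delta <= eps e].  Hence [d <= (t - 1 + eps) e],
    and the coefficient [t] has dropped by the fixed amount [1 - eps].  After
    finitely many steps it is at most [1], and then [d] itself is a lower bound
    of [d] and [e]. *)
Lemma dist_le_of_trunc y y' eps : 0 < eps < 1 ->
  cone_le P (delta y y') (eps *: e) -> cone_le P (d y y') (eps *: e).
Proof.
move=> /andP[eps0 eps1] me.
have le_eZ (a b : R) : a <= b -> cone_le P (a *: e) (b *: e).
  move=> ab; rewrite /cone_le -scalerBl; apply: (coneZ hP); rewrite ?subr_ge0//.
  exact: interior_subset.
have below1 t : t <= 1 -> cone_le P (d y y') (t *: e) ->
    cone_le P (d y y') (eps *: e).
  move=> t1 dt; apply: (cone_le_trans hP) _ me.
  apply: trunc_dist_ge; first exact: cone_le_refl.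
  by apply: (cone_le_trans hP) dt _; have := le_eZ _ _ t1; rewrite scale1r.
have descend n t : t <= 1 + n%:R * (1 - eps) -> cone_le P (d y y') (t *: e) ->
    cone_le P (d y y') (eps *: e).
  elim: n t => [|n IHn] t; first by rewrite mul0r addr0; exact: below1.
  have [/below1//|/ltW t1] := leP t 1 => tn dt.
  apply: (IHn (t - 1 + eps)).
    by move: tn; rewrite -natr1; lra.
  have t1e : cone_le P 0 ((t - 1) *: e).
    by have := le_eZ 0 (t - 1); rewrite scale0r subr_ge0; apply.
  have low : cone_le P (d y y' - (t - 1) *: e) (delta y y').
    apply: trunc_dist_ge; first by rewrite cone_le_subl; exact: cone_le_addl.
    by rewrite cone_le_subl -[X in _ + X]scale1r -scalerDl subrK.
  by have := cone_le_trans hP low me; rewrite cone_le_subl -scalerDl.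
(* Some multiple of e bounds d y y' and starts the descent. *)
have [a a0 ae] := interior_coneB (d y y') Pe.
have b0 : 0 < a / 2 by rewrite divr_gt0.
have bd : cone_le P (d y y') ((a / 2)^-1 *: e).
  rewrite /cone_le.
  have -> : (a / 2)^-1 *: e - d y y' = (a / 2)^-1 *: (e - (a / 2) *: d y y').
    by rewrite scalerBr scalerA mulVf ?scale1r// lt0r_neq0.
  apply: (coneZ hP); first by rewrite invr_ge0 ltW.
  by apply: interior_subset; apply: ae; rewrite b0/= gtr_pMr// invf_lt1 ?ltr1n.
apply: (descend (Num.truncn ((a / 2)^-1 / (1 - eps))).+1) bd.
have : (a / 2)^-1 / (1 - eps) < (Num.truncn ((a / 2)^-1 / (1 - eps))).+1%:R.
  exact: truncnS_gt.
by rewrite ltr_pdivrMr ?subr_gt0// => /ltW h; rewrite (le_trans h)// lerDr.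
Qed.

Lemma unif_dist_ge f g x : cone_le P (delta (f x) (g x)) (rho f g).
Proof. by have [+ _] := unif_dist_lub f g; apply; exists x. Qed.

Lemma unif_dist_le f g b :
  (forall x, cone_le P (delta (f x) (g x)) b) -> cone_le P (rho f g) b.
Proof.
by move=> fgb; have [_] := unif_dist_lub f g; apply=> _ [x _ <-]; exact: fgb.
Qed.

Lemma unif_dist_refl f : cone_le P (rho f f) 0.
Proof.
apply: unif_dist_le => x; apply: (cone_le_trans hP) (d_refl _).
exact: trunc_dist_le.
Qed.

Lemma unif_dist_triangle f g h : cone_le P (rho f g) (rho f h + rho h g).
Proof.
apply: unif_dist_le => x.
apply: (cone_le_trans hP) (trunc_dist_triangle _ _ (h x)) _.
by apply: (cone_leD hP); exact: unif_dist_ge.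
Qed.

Lemma unif_dist_small u : interior P u -> exists2 w, interior P w &
  forall f g, cone_ll P (rho f g) w -> forall x, cone_ll P (d (f x) (g x)) u.
Proof.
move=> Pu; have [a a0 ae] := interior_coneB e Pu.
(* Below [a] to have [eps e << u], below [1] to apply [dist_le_of_trunc]. *)
pose eps := Num.min a 1 / 2.
have m0 : 0 < Num.min a 1 by rewrite lt_min a0 ltr01.
have eps0 : 0 < eps by rewrite divr_gt0.
have : eps < Num.min a 1 by rewrite gtr_pMr// invf_lt1 ?ltr1n.
rewrite lt_min => /andP[epsa eps1].
exists (eps *: e); first exact: interior_coneZ.
move=> f g fge x; apply: (@cone_le_ll_trans _ _ _ hP (eps *: e)).
  apply: dist_le_of_trunc; first by rewrite eps0.
  by apply: (cone_le_trans hP) (unif_dist_ge f g x) _; exact: cone_llW.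
by apply: ae; rewrite eps0.
Qed.

Lemma small_unif_dist u : interior P u -> exists2 w, interior P w &
  forall f g, (forall x, cone_ll P (d (f x) (g x)) w) -> cone_ll P (rho f g) u.
Proof.
move=> Pu; have [v Pv vu] := interior_cone_half hP Pu.
exists v => // f g fgv; apply: (@cone_le_ll_trans _ _ _ hP v).
  apply: unif_dist_le => x; apply: (cone_le_trans hP) (trunc_dist_le _ _) _.
  exact: cone_llW.
by rewrite /cone_ll -vu addrK.
Qed.

End UniformDistance.

(** * Equicontinuity and pointwise limits *)

Section Ascoli.
Context {R : realType} {E : completeNormedModType R} {P : set E}.
Hypothesis hP : is_cone P.
Context {X Y : Type} {dX : X -> X -> E} {dY : Y -> Y -> E}.
Hypothesis dY_refl : forall x, cone_le P (dY x x) 0.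
Hypothesis dY_triangle : forall x y z, cone_le P (dY x y) (dY x z + dY z y).
Hypothesis fb : forall (y_ : nat -> Y) (y : Y),
  fwd_cvg P dY y_ y -> bwd_cvg P dY y_ y.

(** A point [z] of the closure has a point [a] of [A] close to it, measured by
    [d z a]; the estimate from the centre [y] needs [d a z]. *)
Lemma fwd_bounded_closure (A : set Y) : fwd_bounded P dY A ->
  fwd_bounded P dY (closure (A : set (fwd_space P dY))).
Proof.
move=> [y [u [Pu Au]]]; exists y, (u + u); split.
  exact: (interior_coneD hP) Pu (interior_subset Pu).
move=> z zA; have [w Pw zw] := fwd_bwd_ball hP (fb ^~ z) Pu.
have [a Aa za] := closure_fwdP hP dY_refl Pw zA.
exact: (dist_ll_triangle hP dY_triangle) (Au _ Aa) (zw _ za).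
Qed.

(** The approximating function depends on both points [x] and [y]: this allows the
    reversal radius to be chosen at [g y], and covers closures in the uniform
    topology as well as pointwise limits. *)
Lemma fwd_equicontinuous_approx (S S' : set (X -> Y)) :
  fwd_equicontinuous P dX dY S ->
  (forall g, S' g -> forall u, interior P u -> forall x y, exists f,
    [/\ S f, cone_ll P (dY (g x) (f x)) u & cone_ll P (dY (g y) (f y)) u]) ->
  fwd_equicontinuous P dX dY S'.
Proof.
move=> eqS approx x u Pu; have [v Pv <-] := interior_cone_half hP Pu.
have [w Pw wv] := interior_cone_half hP Pv.
have [r [Pr xr]] := eqS x v Pv; exists r; split=> // g y S'g xy.
have [s Ps gys] := fwd_bwd_ball hP (fb ^~ (g y)) Pw.
have [t [Pt ts tw]] := interior_cone_min hP Ps Pw.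
have [f [Sf gfx gfy]] := approx g S'g t Pt x y.
rewrite -{2}wv addrCA; apply: (dist_ll_triangle hP dY_triangle (z := f x)).
  exact: (cone_ll_trans hP) gfx tw.
apply: (dist_ll_triangle hP dY_triangle (z := f y)); first exact: xr.
by apply: gys; exact: (cone_ll_trans hP) gfy ts.
Qed.

Lemma equicontinuous_ff_continuous (S : set (X -> Y)) f :
  fwd_equicontinuous P dX dY S -> S f -> ff_continuous P dX dY f.
Proof.
move=> eqS Sf x x_ x_x u Pu; have [w [Pw xw]] := eqS x u Pu.
by have [N xN] := x_x w Pw; exists N => n /xN; exact: xw.
Qed.

End Ascoli.

(** * Relative compactness *)

Theorem theorem3p24 (R : realType) (E : completeNormedModType R) (P : set E)
    (hP : is_cone P) (hPint : interior P !=set0)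
    (X Y : Type) (dX : X -> X -> E) (dY : Y -> Y -> E)
    (hX : is_quasi_cone_metric P dX) (hY : is_quasi_cone_metric P dY)
    (hXc : fwd_compact P dX [set: X])
    (hYfb : forall (y_ : nat -> Y) (y : Y),
      fwd_cvg P dY y_ y -> bwd_cvg P dY y_ y)
    (hYhb : forall A : set Y,
      fwd_bounded P dY A -> fwd_closed P dY A -> fwd_compact P dY A)
    (e : E) (he : interior P e)
    (hrho : unif_dist_exists P X dY e)
    (S : set (ff_map P dX dY))
    (hSeq : fwd_equicontinuous P dX dY [set sval f | f in S])
    (hSbd : fwd_pointwise_bounded P dY [set sval f | f in S]) :
  fwd_relatively_compact P (unif_metric (P := P) (dX := dX) (dY := dY) e) S.
Proof.
have dX_refl x : cone_le P (dX x x) 0.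
  by rewrite ((qcm_eq0 hX x x).2 erefl); exact: cone_le_refl.
have dY_refl y : cone_le P (dY y y) 0.
  by rewrite ((qcm_eq0 hY y y).2 erefl); exact: cone_le_refl.
have dY_ge0 := qcm_ge0 hY; have dY_tri := qcm_triangle hY.
set rho := unif_metric e.
have rho_refl f : cone_le P (rho f f) 0 by exact: unif_dist_refl.
have rho_tri f g h : cone_le P (rho f g) (rho f h + rho h g).
  exact: unif_dist_triangle.
pose C := closure (S : set (fwd_space P rho)).
have near_S f w : C f -> interior P w -> exists2 s, S s &
    forall x, cone_ll P (dY (sval f x) (sval s x)) w.
  move=> Cf Pw; have [v Pv rhov] := unif_dist_small hP he hrho Pw.
  have [s Ss fs] := closure_fwdP hP rho_refl Pv Cf.
  by exists s => // x; exact: rhov.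
have eqC : fwd_equicontinuous P dX dY [set sval f | f in C].
  apply: (fwd_equicontinuous_approx hP dY_tri hYfb hSeq).
  move=> _ [f Cf <-] u Pu x y.
  by have [s Ss fs] := near_S f u Cf Pu; exists (sval s); split=> //; exists s.
apply/compact_cover_compact; rewrite compact_ultra => F FU FC.
pose ev x (f : fwd_space P rho) : fwd_space P dY := sval f x.
have /choice[g g_lim] x : exists p : fwd_space P dY, ev x @ F --> p.
  pose K := closure
    ([set f x | f in [set sval f | f in S]] : set (fwd_space P dY)).
  have : compact K.
    apply/compact_cover_compact; apply: hYhb; last exact: closed_closure.
    exact: (fwd_bounded_closure hP dY_refl dY_tri hYfb).
  have FK : F (ev x @^-1` K).
    apply: filterS FC => f Cf B /(nbhs_fwdP hP dY_tri hPint)[w Pw wB].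
    have [s Ss fs] := near_S f w Cf Pw.
    exists (sval s x); split; last exact: (wB _ (fs x)).
    by exists (sval s) => //; exists s.
  rewrite compact_ultra => /(_ _ (ultra_fmap (ev x) FU) FK)[p [_ Fp]].
  by exists p.
have g_near x u : interior P u -> F [set f | cone_ll P (dY (g x) (sval f x)) u].
  by move=> Pu; exact: (g_lim x _ (nbhs_fwd_ball hP dY_refl (g x) Pu)).
have eqg : fwd_equicontinuous P dX dY [set g].
  apply: (fwd_equicontinuous_approx hP dY_tri hYfb eqC) => _ -> u Pu x y.
  have [f [Cf [fx fy]]] := filter_ex
    (filterI FC (filterI (g_near x u Pu) (g_near y u Pu))).
  by exists (sval f); split=> //; exists f.
have g_ff : ff_continuous P dX dY g by exact: equicontinuous_ff_continuous eqg _.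
pose G : fwd_space P rho := exist _ g g_ff.
have FG : F --> G.
  move=> A /(nbhs_fwdP hP rho_tri hPint)[u Pu uA]; apply: filterS uA _.
  have [w Pw wu] := small_unif_dist hP hrho Pu.
  have [v Pv vw] := interior_cone_half hP Pw.
  have [t Pt tv] := interior_cone_half hP Pv.
  (* The distance [d (g y) (g x)] is reversed at the fixed point [g x]. *)
  have /choice[r_ r_P] x : exists r, interior P r /\
      forall y, cone_ll P (dX x y) r -> cone_ll P (dY (g y) (g x)) t /\
      forall f, C f -> cone_ll P (dY (sval f x) (sval f y)) t.
    have [s Ps gs] := fwd_bwd_ball hP (hYfb ^~ (g x)) Pt.
    have [r1 [Pr1 xr1]] := eqg x s Ps; have [r2 [Pr2 xr2]] := eqC x t Pt.
    have [r [Pr rr1 rr2]] := interior_cone_min hP Pr1 Pr2.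
    exists r; split=> // y xy; split=> [|f Cf].
      by apply: gs; apply: xr1 => //; exact: (cone_ll_trans hP) xy rr1.
    by apply: xr2; [exists f|exact: (cone_ll_trans hP) xy rr2].
  have [||D _ XD] :=
    hXc (fwd_space P dX) setT (fun x => fwd_ball P dX x (r_ x)).
  - by move=> x _; apply: open_fwd_ball; have [] := r_P x.
  - move=> x _; exists x => //; apply: (dist_refl_ll hP dX_refl).
    by have [] := r_P x.
  have FD : F (\bigcap_(x in [set` D])
      [set f | cone_ll P (dY (g x) (sval f x)) v]).
    by apply: filter_bigI => x _; exact: g_near.
  apply: filterS (filterI FC FD) => f [Cf fD]; apply: wu => y /=.
  have [x Dx /(r_P x).2[gyx fxy]] := XD y Logic.I.
  rewrite -vw -{1}tv addrAC -addrA.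
  apply: (dist_ll_triangle hP dY_tri (z := g x)) => //.
  apply: (dist_ll_triangle hP dY_tri (z := sval f x)); last exact: fxy.
  exact: fD.
exists G; split=> //; apply: closed_closure => B /FG FB.
exact: filter_ex (filterI FC FB).
Qed.
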